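(* Let $K$ be a field and let $H\in\mathcal N_2$ be a normal affine semigroup in $\mathbb N^2$ with extremal rays $\mathbf a_1=(x_1,y_1)$ and $\mathbf a_2=(x_2,y_2)$, labeled so that $\mathbf a_1$ is closer to the $x$-axis. If $\mathbf b=(u,v)$ is the bottom element of $H$, then the $K$-algebra $K[H]$ is Gorenstein if and only if $vx_1-uy_1=uy_2-vx_2=1$.
   Context: $\mathbb N=\{0,1,2,\dots\}$. $\mathcal N_2$ is the class of normal affine semigroups $H\subseteq\mathbb N^2$ generating $\mathbb Z^2$ as a group: $H$ is a finitely generated submonoid of $\mathbb N^2$ with $H=C\cap\mathbb Z^2$, where $C\subseteq\mathbb R^2$ is the (two-dimensional) cone generated by $H$. The extremal rays of $H$ are the primitive lattice vectors $\mathbf a_1,\mathbf a_2\in H$ lying on the two extremal rays of $C$. They are labeled $\mathbf a_1=(x_1,y_1)$, $\mathbf a_2=(x_2,y_2)$ so that $x_1>0$ and either $x_2=0$ or $y_1/x_1<y_2/x_2$. Put $\omega_H=\mathbb Z^2\cap\operatorname{relint}C$. The bottom element $\mathbf b$ of $H$ is the unique element of $\omega_H$ that is minimal (least) in $\omega_H$ for the componentwise order on $\mathbb N^2$ (it always exists). $K[H]$ is the subalgebra of the polynomial ring in two variables over $K$ spanned by the monomials $\mathbf x^{\mathbf h}$, $\mathbf h\in H$; it is Cohen–Macaulay, with canonical module the ideal spanned by the monomials $\mathbf x^{\mathbf h}$, $\mathbf h\in\omega_H$. *)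

(* Defs.v *)
From HB Require Import structures.
From mathcomp Require Import all_boot all_order all_algebra.
From mathcomp Require Import boolp reals.
From mathcomp Require Import mpoly.

Set Implicit Arguments.
Unset Strict Implicit.
Unset Printing Implicit Defensive.

Import Order.TTheory GRing.Theory Num.Theory.
Local Open Scope ring_scope.

Definition vecZ (h : nat * nat) : int * int := (h.1%:Z, h.2%:Z).

Definition vecR (R : realType) (z : int * int) : R * R := (z.1%:~R, z.2%:~R).

Definition lincomb (S : pzRingType) (s : seq (S * (S * S))) : S * S :=
  (\sum_(t <- s) t.1 * t.2.1, \sum_(t <- s) t.1 * t.2.2).

Record submonoid2 := Submonoid2 {
  smem :> nat * nat -> Prop;
  smem0 : smem (0, 0)%N;
  smemD : forall g h : nat * nat,
    smem g -> smem h -> smem (g.1 + h.1, g.2 + h.2)%N }.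

Definition finitely_generated (H : submonoid2) : Prop :=
  exists s : seq (nat * nat), forall h : nat * nat,
    H h <-> exists c : nat * nat -> nat,
              h = (\sum_(g <- s) c g * g.1, \sum_(g <- s) c g * g.2)%N.

Definition generates_Z2 (H : submonoid2) : Prop :=
  forall z : int * int, exists s : seq (int * (nat * nat)),
    (forall t, t \in s -> H t.2) /\
    z = lincomb [seq (t.1, vecZ t.2) | t <- s].

Definition cone (R : realType) (H : submonoid2) (z : R * R) : Prop :=
  exists s : seq (R * (nat * nat)),
    (forall t, t \in s -> 0 <= t.1 /\ H t.2) /\
    z = lincomb [seq (t.1, vecR R (vecZ t.2)) | t <- s].

Definition affine_hull (R : realType) (A : R * R -> Prop) (z : R * R) : Prop :=
  exists s : seq (R * (R * R)),
    [/\ forall t, t \in s -> A t.2,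
        \sum_(t <- s) t.1 = 1
      & z = lincomb s].

Definition relint (R : realType) (A : R * R -> Prop) (z : R * R) : Prop :=
  A z /\ exists e : R, 0 < e /\
    forall w : R * R, affine_hull A w ->
      `|w.1 - z.1| < e -> `|w.2 - z.2| < e -> A w.

Definition normal_affine2 (R : realType) (H : submonoid2) : Prop :=
  [/\ finitely_generated H,
      generates_Z2 H
    & forall z : int * int,
        cone H (vecR R z) <-> exists h : nat * nat, H h /\ z = vecZ h].

Definition ray (R : realType) (a : nat * nat) (z : R * R) : Prop :=
  exists c : R, 0 <= c /\ z = (c * a.1%:R, c * a.2%:R).

(* [a] is a primitive vector ([coprime] excludes [(0, 0)]) of [H] spanning an
   extremal ray of the cone, that is, a one-dimensional face. *)
Definition extremal_ray (R : realType) (H : submonoid2) (a : nat * nat) : Prop :=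
  [/\ H a,
      coprime a.1 a.2
    & forall p q : R * R, cone H p -> cone H q ->
        ray a (p.1 + q.1, p.2 + q.2) -> ray a p /\ ray a q].

Definition omega (R : realType) (H : submonoid2) (z : int * int) : Prop :=
  relint (@cone R H) (vecR R z).

Definition bottom_element (R : realType) (H : submonoid2) (b : nat * nat) : Prop :=
  omega R H (vecZ b) /\
  forall w : int * int, omega R H w -> b.1%:Z <= w.1 /\ b.2%:Z <= w.2.

Definition expo (m : 'X_{1..2}) : nat * nat := (m ord0, m ord_max).

Section SemigroupAlgebra.
Variables (K : fieldType) (H : submonoid2).

Definition sgalg_pred : {pred {mpoly K[2]}} :=
  fun p => all (fun m => `[< H (expo m) >]) (msupp p).

Lemma sgalg_predP (p : {mpoly K[2]}) :
  reflect (forall m, m \in msupp p -> H (expo m)) (p \in sgalg_pred).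
Proof. by apply: (iffP allP) => h m /h /asboolP. Qed.

Lemma sgalg_subalg_closed : GRing.subalg_closed sgalg_pred.
Proof.
split=> [|c p q /sgalg_predP hp /sgalg_predP hq|p q /sgalg_predP hp /sgalg_predP hq].
- apply/sgalg_predP => m; rewrite msupp1 inE => /eqP->.
  by rewrite /expo !mnm0E; exact: smem0.
- apply/sgalg_predP => m /msuppD_le; rewrite mem_cat.
  by case/orP=> [/msuppZ_le/hp|/hq].
- apply/sgalg_predP => m /msuppM_le /allpairsP[[m1 m2] /= [h1 h2 ->]].
  rewrite /expo !mnmDE.
  exact: (smemD (hp _ h1) (hq _ h2)).
Qed.

HB.instance Definition _ :=
  GRing.isSubalgClosed.Build K {mpoly K[2]} sgalg_pred sgalg_subalg_closed.

(* The algebra K[H], as the subalgebra of K[x, y] spanned by the monomials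
   with exponent in H. *)
Record sgalg := SgAlg { sgval : {mpoly K[2]}; _ : sgval \in sgalg_pred }.

HB.instance Definition _ := [isSub for sgval].
HB.instance Definition _ := [Choice of sgalg by <:].
HB.instance Definition _ := [SubChoice_isSubComNzRing of sgalg by <:].
HB.instance Definition _ := [SubZmodule_isSubLmodule of sgalg by <:].
HB.instance Definition _ := [SubNzRing_SubLmodule_isSubLalgebra of sgalg by <:].
HB.instance Definition _ := [SubLalgebra_isSubAlgebra of sgalg by <:].

End SemigroupAlgebra.

(* The ideal of K[H] spanned by the monomials with exponent in omega_H; by the
   Danilov-Stanley theorem it is the canonical module of K[H]. *)
Definition canonical_ideal (R : realType) (K : fieldType) (H : submonoid2)
    (p : sgalg K H) : Prop :=
  forall m, m \in msupp (sgval p) -> omega R H (vecZ (expo m)).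

Definition is_ideal (A : comNzRingType) (I : A -> Prop) : Prop :=
  [/\ I 0, forall p q, I p -> I q -> I (p + q) & forall a p, I p -> I (a * p)].

Definition maximal_ideal (A : comNzRingType) (P : A -> Prop) : Prop :=
  [/\ is_ideal P, ~ P 1
    & forall J : A -> Prop, is_ideal J -> (forall p, P p -> J p) ->
        (forall p, J p -> P p) \/ J 1].

(* The localization W_P of an ideal W is a free A_P-module of rank one. A
   generator can be taken of the form f/1 with f in W; the two clauses say that
   f/1 generates W_P and that its annihilator in A_P is zero. *)
Definition locally_free1_at (A : comNzRingType) (W P : A -> Prop) : Prop :=
  exists f : A, [/\ W f,
    forall w, W w -> exists s a : A, ~ P s /\ s * w = a * f
  & forall a, a * f = 0 -> exists s : A, ~ P s /\ s * a = 0].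

(* A Cohen-Macaulay ring A whose canonical module is (isomorphic to) the ideal W
   is Gorenstein when W_P is isomorphic to A_P for every maximal ideal P, see
   Bruns-Herzog, Cohen-Macaulay rings, Theorem 3.3.7 and Definition 3.3.16. *)
Definition gorenstein_with_canonical (A : comNzRingType) (W : A -> Prop) : Prop :=
  forall P : A -> Prop, maximal_ideal P -> locally_free1_at W P.

Definition semigroup_ring_gorenstein (R : realType) (K : fieldType)
    (H : submonoid2) : Prop :=
  gorenstein_with_canonical (@canonical_ideal R K H).

(* Main.v *)
Require Import Defs.
From mathcomp Require Import all_boot all_order all_algebra.
From mathcomp Require Import boolp reals.
From mathcomp Require Import mpoly ring lra zify.
Import Order.TTheory GRing.Theory Num.Theory.
Local Open Scope ring_scope.

Set Implicit Arguments.
Unset Strict Implicit.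
Unset Printing Implicit Defensive.

(* The functionals L1 = det(a1, .) and L2 = det(., a2) cut out the cone, so omega
   consists of the lattice points where both are positive. Localizing at the ideal
   of polynomials without constant term and comparing coefficients, a local
   generator of the canonical ideal forces omega = b + H. As omega contains points
   with L1 = 1 and points with L2 = 1, this gives L1 b = L2 b = 1. Conversely,
   L1 b = L2 b = 1 gives omega = b + H, and the canonical ideal is generated by
   the monomial x^b. *)

(** * Determinants and the cone spanned by the semigroup *)

Definition det2 {S : pzRingType} (p q : S * S) : S := p.1 * q.2 - p.2 * q.1.

Definition natv (S : pzSemiRingType) (a : nat * nat) : S * S := (a.1%:R, a.2%:R).

Lemma vecR_vecZ (R : realType) (h : nat * nat) : vecR R (vecZ h) = natv R h.
Proof. by []. Qed.

Lemma cone_pair (R : realType) (H : submonoid2) (g h : nat * nat) (c d : R) :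
  H g -> H h -> 0 <= c -> 0 <= d ->
  cone H (c * g.1%:R + d * h.1%:R, c * g.2%:R + d * h.2%:R).
Proof.
move=> Hg Hh c0 d0; exists [:: (c, g); (d, h)]; split.
  by move=> t; rewrite !inE => /orP[]/eqP->.
by rewrite /lincomb /= !big_cons !big_nil /= !addr0.
Qed.

Lemma cone_halfplane (R : realType) (H : submonoid2) (a : R * R) (z : R * R) :
  (forall h : nat * nat, H h -> 0 <= det2 a (natv R h)) -> cone H z ->
  0 <= det2 a z.
Proof.
move=> aH [s [sH ->]]; rewrite /det2 /lincomb /= !big_map !mulr_sumr -sumrB.
rewrite big_seq; apply: sumr_ge0 => t /sH[t0 /aH].
rewrite /det2 /= => h0.
have -> : a.1 * (t.1 * t.2.2%:~R) - a.2 * (t.1 * t.2.1%:~R)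
  = t.1 * (a.1 * t.2.2%:R - a.2 * t.2.1%:R) by rewrite /=; ring.
exact: mulr_ge0.
Qed.

(* If [h] and [c] were on opposite sides of the line through [a], then [a]
   would be a positive combination of [h] and [c], contradicting extremality. *)
Lemma extremal_ray_side (R : realType) (H : submonoid2) (a c h : nat * nat) :
  extremal_ray R H a -> H c -> H h -> det2 (natv R a) (natv R c) != 0 ->
  0 <= det2 (natv R a) (natv R c) * det2 (natv R a) (natv R h).
Proof.
move=> [Ha cop face] Hc Hh d0; rewrite leNgt; apply/negP => neg.
set d := det2 _ (natv R c) in d0 neg *; set e := det2 _ (natv R h) in neg.
have Cp : cone H (d ^+ 2 * h.1%:R + 0 * h.1%:R, d ^+ 2 * h.2%:R + 0 * h.2%:R : R).
  by apply: cone_pair; rewrite ?sqr_ge0.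
have Cq : cone H (- (d * e) * c.1%:R + 0 * c.1%:R, - (d * e) * c.2%:R + 0 * c.2%:R).
  by apply: cone_pair => //; rewrite oppr_ge0 ltW.
case: (face _ _ Cp Cq) => [|_ [k [_ [k1 k2]]]] /=.
  (* Cramer's identity [d * h - e * c = det2 h c * a], scaled by [d]. The factor is nonnegative
     because the sum has nonnegative coordinates and [a] has a positive one. *)
  exists (d * det2 (natv R h) (natv R c)).
  have E : (d ^+ 2 * h.1%:R + 0 * h.1%:R + (- (d * e) * c.1%:R + 0 * c.1%:R),
      d ^+ 2 * h.2%:R + 0 * h.2%:R + (- (d * e) * c.2%:R + 0 * c.2%:R)) =
     (d * det2 (natv R h) (natv R c) * a.1%:R,
      d * det2 (natv R h) (natv R c) * a.2%:R).
    by rewrite /e /d /det2 /=; congr pair; ring.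
  split=> //; move: E => [E1 E2].
  have P (n m : nat): 0 <= d ^+ 2 * n%:R + 0 * n%:R + (- (d * e) * m%:R + 0 * m%:R).
    by rewrite !mul0r !addr0 addr_ge0 // mulr_ge0 ?sqr_ge0 // oppr_ge0 ltW.
  case: (posnP a.1) => [a10|a1].
    have a2 : (0 < a.2)%N by move: cop; rewrite a10 /coprime gcd0n => /eqP->.
    by rewrite -(pmulr_lge0 _ (_ : 0 < a.2%:R)) ?ltr0n // -E2.
  by rewrite -(pmulr_lge0 _ (_ : 0 < a.1%:R)) ?ltr0n // -E1.
move: k1 k2; rewrite !mul0r !addr0 => k1 k2.
(* The face property puts [- (d * e) * c] on the ray of [a], so its determinant with [a]
   vanishes. *)
have : d * (d * e) = 0.
  transitivity (- (a.1%:R * (- (d * e) * c.2%:R) - a.2%:R * (- (d * e) * c.1%:R))).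
    by rewrite {1}/d /det2 /=; ring.
  by rewrite k1 k2; ring.
by move/eqP; rewrite mulf_eq0 (negPf d0) (lt_eqF neg).
Qed.

(** Extremality puts all of [H] on the same side of each ray as the other ray. Conversely, Cramer's
    rule writes [z] as a nonnegative combination of [a1] and [a2]. *)
Lemma coneP (R : realType) (H : submonoid2) (a1 a2 : nat * nat) (z : R * R) :
  extremal_ray R H a1 -> extremal_ray R H a2 ->
  0 < det2 (natv R a1) (natv R a2) ->
  cone H z <-> 0 <= det2 (natv R a1) z /\ 0 <= det2 z (natv R a2).
Proof.
move=> r1 r2 D0; have [Ha1 _ _] := r1; have [Ha2 _ _] := r2.
have anti (p q : R * R) : det2 q p = - det2 p q by rewrite /det2; ring.
split=> [Cz|[L1 L2]].
  split.
    apply: cone_halfplane Cz => h Hh.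
    by have := extremal_ray_side r1 Ha2 Hh; rewrite gt_eqF // pmulr_rge0 //; apply.
  have -> : det2 z (natv R a2) = det2 (- a2.1%:R, - a2.2%:R) z by rewrite /det2 /=; ring.
  apply: cone_halfplane Cz => h Hh.
  have := extremal_ray_side r2 Ha1 Hh; rewrite (anti (natv R a1)) oppr_eq0 gt_eqF //.
  rewrite mulNr -mulrN pmulr_rge0 // => /(_ isT).
  by congr (_ <= _); rewrite /det2 /=; ring.
set D := det2 (natv R a1) (natv R a2) in D0.
have := cone_pair Ha1 Ha2 (divr_ge0 L2 (ltW D0)) (divr_ge0 L1 (ltW D0)).
congr cone; rewrite [RHS]surjective_pairing.
have Dn : D != 0 by rewrite gt_eqF.
by congr pair; apply: (mulIf Dn); rewrite mulrDl -!mulrA !(mulrCA D^-1) !mulrA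
  !(mulfVK, mulVf) //; rewrite -?mulrA ?(mulrC D) ?divff ?mulVf // /D /det2 /=; field.
Qed.

(** * Relative interior of the cone *)

(** The points [a1], [a2] and the origin are affinely independent, so [relint] of the cone is its
    interior in the plane. *)
Lemma affine_hull_cone (R : realType) (H : submonoid2) (a1 a2 : nat * nat) (z : R * R) :
  H a1 -> H a2 -> 0 < det2 (natv R a1) (natv R a2) -> affine_hull (cone H) z.
Proof.
move=> Ha1 Ha2; set D := det2 _ _ => D0.
have C (h : nat * nat) : H h -> cone H (natv R h).
  move=> Hh; have := cone_pair Hh Hh (@ler01 R) (lexx 0).
  by rewrite !mul1r !mul0r !addr0.
set c := det2 z (natv R a2) / D; set d := det2 (natv R a1) z / D.
exists [:: (c, natv R a1); (d, natv R a2); (1 - c - d, natv R (0, 0)%N)]; split.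
- move=> t; rewrite !inE => /or3P[]/eqP-> /=; apply: C => //; exact: smem0.
- by rewrite !big_cons big_nil /=; ring.
- rewrite /lincomb !big_cons !big_nil /= [LHS]surjective_pairing.
  by congr pair; rewrite /c /d /D /det2 /=; field; rewrite gt_eqF.
Qed.

Lemma ltr_small_mul (R : realType) (e : R) (n m : nat) : 0 < e ->
  `|e / (n + m).+1%:R * n%:R| < e.
Proof.
move=> e0; rewrite ger0_norm; last by rewrite mulr_ge0 // divr_ge0 // ltW.
by rewrite -mulrA gtr_pMr // mulrC ltr_pdivrMr // mul1r ltr_nat ltnS leq_addr.
Qed.

Lemma relint_coneP (R : realType) (H : submonoid2) (a1 a2 : nat * nat) (z : R * R) :
  extremal_ray R H a1 -> extremal_ray R H a2 ->
  0 < det2 (natv R a1) (natv R a2) ->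
  relint (cone H) z <-> 0 < det2 (natv R a1) z /\ 0 < det2 z (natv R a2).
Proof.
move=> r1 r2 D0; have [Ha1 _ _] := r1; have [Ha2 _ _] := r2.
have hull w := affine_hull_cone w Ha1 Ha2 D0.
split=> [[Cz [e [e0 ball]]]|[L1 L2]].
  (* Moving [z] backwards along [a] by this [t] changes each coordinate by less than [e]. *)
  have step (a : nat * nat) t : t = e / (a.1 + a.2).+1%:R ->
      cone H (z.1 - t * a.1%:R, z.2 - t * a.2%:R).
    move=> ->; apply: ball (hull _) _ _ => /=; rewrite addrAC subrr add0r normrN.
      exact: ltr_small_mul.
    by rewrite addnC; exact: ltr_small_mul.
  have pos (a : nat * nat) : 0 < e / (a.1 + a.2).+1%:R by rewrite divr_gt0.
  (* Backing off along one ray lowers the determinant with the other by a positive amount and leaves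
     it nonnegative, so it was positive before. *)
  split.
    have /(coneP _ r1 r2 D0)[+ _] := step a2 _ erefl.
    have -> t : det2 (natv R a1) (z.1 - t * a2.1%:R, z.2 - t * a2.2%:R) =
       det2 (natv R a1) z - t * det2 (natv R a1) (natv R a2) by rewrite /det2 /=; ring.
    by rewrite subr_ge0; apply: lt_le_trans; rewrite mulr_gt0.
  have /(coneP _ r1 r2 D0)[_ +] := step a1 _ erefl.
  have -> t : det2 (z.1 - t * a1.1%:R, z.2 - t * a1.2%:R) (natv R a2) =
     det2 z (natv R a2) - t * det2 (natv R a1) (natv R a2) by rewrite /det2 /=; ring.
  by rewrite subr_ge0; apply: lt_le_trans; rewrite mulr_gt0.
split; first by apply/(coneP _ r1 r2 D0); rewrite !ltW.
(* [m] is the slack of the tighter inequality; the successor in [M] only keeps the denominator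
   positive. *)
set m := Num.min (det2 (natv R a1) z) (det2 z (natv R a2)).
have m0 : 0 < m by rewrite lt_min L1.
set M := (a1.1 + a1.2 + a2.1 + a2.2).+1%:R : R.
exists (m / M); split; first by rewrite divr_gt0.
move=> w _ w1 w2; apply/(coneP _ r1 r2 D0).
(* The determinants are Lipschitz in [w] with constant at most [M]. *)
have lip (n k : nat) : (n + k <= a1.1 + a1.2 + a2.1 + a2.2)%N ->
    `|n%:R * (w.2 - z.2)| + `|k%:R * (w.1 - z.1)| <= m.
  move=> le; rewrite !normrM !normr_nat.
  apply: (@le_trans _ _ (n%:R * (m / M) + k%:R * (m / M))).
    by apply: lerD; apply: ler_wpM2l => //; apply: ltW.
  rewrite -mulrDl -natrD mulrCA ger_pMr // ler_pdivrMr // mul1r ler_nat.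
  exact: leqW.
have m1 : m <= det2 (natv R a1) z by rewrite ge_min lexx.
have m2 : m <= det2 z (natv R a2) by rewrite ge_min lexx orbT.
split.
  have := lip a1.1 a1.2; rewrite -!addnA leq_add2l leq_addr => /(_ isT).
  have -> : det2 (natv R a1) w =
    det2 (natv R a1) z + (a1.1%:R * (w.2 - z.2) - a1.2%:R * (w.1 - z.1)).
    by rewrite /det2 /=; ring.
  move: (a1.1%:R * _) (a1.2%:R * _) => x y le.
  have := ler_norm (- x); have := ler_norm y; rewrite normrN; lra.
have := lip a2.1 a2.2; rewrite -!addnA [leqRHS]addnA leq_addl => /(_ isT).
have -> : det2 w (natv R a2) =
  det2 z (natv R a2) - (a2.1%:R * (w.2 - z.2) - a2.2%:R * (w.1 - z.1)).
  by rewrite /det2 /=; ring.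
move: (a2.1%:R * _) (a2.2%:R * _) => x y le.
have := ler_norm x; have := ler_norm (- y); rewrite normrN; lra.
Qed.

(** * Lattice points of the cone and of its interior *)

Lemma det2_intr (R : realType) (a b : int * int) :
  det2 (vecR R a) (vecR R b) = (det2 a b)%:~R.
Proof. by rewrite /det2 /= rmorphB !rmorphM. Qed.

Lemma omegaP (R : realType) (H : submonoid2) (a1 a2 : nat * nat) (z : int * int) :
  extremal_ray R H a1 -> extremal_ray R H a2 -> 0 < det2 (vecZ a1) (vecZ a2) ->
  omega R H z <-> 0 < det2 (vecZ a1) z /\ 0 < det2 z (vecZ a2).
Proof.
move=> r1 r2; rewrite -(ltr0z R) -det2_intr !vecR_vecZ => D0.
rewrite /omega (relint_coneP _ r1 r2 D0) -!vecR_vecZ !det2_intr !ltr0z.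
by [].
Qed.

Lemma normal_memP (R : realType) (H : submonoid2) (a1 a2 : nat * nat) (z : int * int) :
  normal_affine2 R H -> extremal_ray R H a1 -> extremal_ray R H a2 ->
  0 < det2 (vecZ a1) (vecZ a2) ->
  (exists2 h, H h & z = vecZ h) <-> 0 <= det2 (vecZ a1) z /\ 0 <= det2 z (vecZ a2).
Proof.
move=> [_ _ norm] r1 r2; rewrite -(ltr0z R) -det2_intr !vecR_vecZ => D0.
have := coneP (vecR R z) r1 r2 D0; rewrite -!vecR_vecZ !det2_intr !ler0z => <-.
by rewrite norm; split=> [[h Hh ->]|[h [Hh ->]]]; exists h.
Qed.

Lemma coprime_det2_1 (a : nat * nat) : coprime a.1 a.2 ->
  exists z, det2 (vecZ a) z = 1.
Proof.
rewrite /coprime => /eqP g1; have [u [v]] := Bezoutz a.1%:Z a.2%:Z.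
rewrite /gcdz /= g1 => E; exists (- v, u); rewrite /det2 /=; lia.
Qed.

(** * Monomials and the semigroup algebra *)

Definition mnm_of (h : nat * nat) : 'X_{1..2} :=
  [multinom if i == ord0 then h.1 else h.2 | i < 2].

Lemma mnm_ofK (h : nat * nat) : expo (mnm_of h) = h.
Proof. by rewrite /expo !mnmE /=; case: h. Qed.

Lemma expoK (m : 'X_{1..2}) : mnm_of (expo m) = m.
Proof.
apply/mnmP => i; rewrite mnmE /expo /=.
have [->//|i0] := eqVneq i ord0.
by congr (m _); apply/val_inj; case: i i0 => -[|[|]].
Qed.

Lemma expoD (m n : 'X_{1..2}) :
  expo (m + n)%MM = ((expo m).1 + (expo n).1, (expo m).2 + (expo n).2)%N.
Proof. by rewrite /expo !mnmDE. Qed.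

Lemma sgmon_subproof (K : fieldType) (H : submonoid2) (h : nat * nat) :
  H h -> ('X_[mnm_of h] : {mpoly K[2]}) \in sgalg_pred H.
Proof.
by move=> Hh; apply/sgalg_predP => m; rewrite msuppX inE => /eqP->; rewrite mnm_ofK.
Qed.

Definition sgmon (K : fieldType) (H : submonoid2) (h : nat * nat) (Hh : H h) :
  sgalg K H := SgAlg (sgmon_subproof K Hh).

Lemma sgvalP (K : fieldType) (H : submonoid2) (p : sgalg K H) (m : 'X_{1..2}) :
  m \in msupp (sgval p) -> H (expo m).
Proof. by case: p => p /= /sgalg_predP; apply. Qed.

Lemma sgvalM (K : fieldType) (H : submonoid2) (p q : sgalg K H) :
  sgval (p * q) = sgval p * sgval q.
Proof. exact: (rmorphM (val : sgalg K H -> {mpoly K[2]})). Qed.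

Lemma sgvalD (K : fieldType) (H : submonoid2) (p q : sgalg K H) :
  sgval (p + q) = sgval p + sgval q.
Proof. exact: (rmorphD (val : sgalg K H -> {mpoly K[2]})). Qed.

Lemma sgvalB (K : fieldType) (H : submonoid2) (p q : sgalg K H) :
  sgval (p - q) = sgval p - sgval q.
Proof. exact: (rmorphB (val : sgalg K H -> {mpoly K[2]})). Qed.

Lemma sgvalZ (K : fieldType) (H : submonoid2) (c : K) (p : sgalg K H) :
  sgval (c *: p) = c *: sgval p.
Proof. exact: (GRing.valZ (c : K) (p : sgalg K H)). Qed.

Lemma sgval1 (K : fieldType) (H : submonoid2) : sgval (1 : sgalg K H) = 1.
Proof. exact: (rmorph1 (val : sgalg K H -> {mpoly K[2]})). Qed.

Lemma sgval0 (K : fieldType) (H : submonoid2) : sgval (0 : sgalg K H) = 0.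
Proof. exact: (rmorph0 (val : sgalg K H -> {mpoly K[2]})). Qed.

Definition const_coef (K : fieldType) (H : submonoid2) (p : sgalg K H) : K :=
  (sgval p)@_0.

(* An ideal strictly above the kernel of the constant coefficient contains some
   [p] with [const_coef p = c != 0], hence [1 = c^-1 p + (1 - c^-1 p)]. *)
Lemma const_coef_maximal (K : fieldType) (H : submonoid2) :
  maximal_ideal (fun p : sgalg K H => const_coef p = 0).
Proof.
split; rewrite /const_coef.
- split=> [|p q p0 q0|a p p0]; rewrite ?sgval0 ?mcoeff0 //.
    by rewrite sgvalD mcoeffD p0 q0 addr0.
  by rewrite sgvalM rmorphM /= p0 mulr0.
- by rewrite sgval1 rmorph1; apply/eqP; rewrite oner_eq0.
move=> J [J0 JD JM] sub; have [le|] := pselect (forall p, J p -> (sgval p)@_0 = 0).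
  by left.
case/existsNP => p /not_implyP[Jp /eqP pN0]; right.
set c := (sgval p)@_0 in pN0.
rewrite -[1](subrK (c^-1 *: 1 * p)); apply: JD; last exact: JM.
apply: sub; rewrite -scalerAl mul1r sgvalB sgval1 sgvalZ.
by rewrite mcoeffB mcoeffZ mcoeff1 eqxx mulVf // subrr.
Qed.

Lemma mcoeff_mulX (K : fieldType) (p : {mpoly K[2]}) (m : 'X_{1..2}) :
  (p * 'X_[m])@_m = p@_0.
Proof. by have := mcoeffMX p m 0%MM; rewrite addm0. Qed.

(** * Local freeness of a monomial ideal and translates of [H] *)

(** Eliminating [f] from [s * x^b = a * f] and [s' * x^w = a' * f] gives
    [a' * s * x^b = a * s' * x^w]. Once [a] and [s'] have nonzero constant coefficients, [x^w]
    occurs on the right, hence is [x^b] times a monomial of [a' * s]. *)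
Lemma sgalg_gorenstein_translate (K : fieldType) (H : submonoid2)
    (W : nat * nat -> Prop) (b w : nat * nat) :
  (forall h, W h -> H h) -> W b ->
  (forall h, W h -> (b.1 <= h.1)%N /\ (b.2 <= h.2)%N) ->
  gorenstein_with_canonical
    (fun p : sgalg K H => forall m, m \in msupp (sgval p) -> W (expo m)) ->
  W w -> exists2 g, H g & w = (b.1 + g.1, b.2 + g.2)%N.
Proof.
move=> WH Wb bmin /(_ _ (const_coef_maximal K H)) [f [Wf gen _]] Ww.
have mon h (Wh : W h) : forall m, m \in msupp (sgval (sgmon K (WH _ Wh))) -> W (expo m).
  by move=> m; rewrite msuppX inE => /eqP->; rewrite mnm_ofK.
have [s [a [/eqP s0 /(congr1 (@sgval _ _)) /=]]] := gen _ (mon _ Wb).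
move=> E.
have [s' [a' [/eqP s'0 /(congr1 (@sgval _ _)) /=]]] := gen _ (mon _ Ww).
move=> E'.
(* Some [m1] from [a] and [m2] from [f] add up to [b]; as [m2] lies in [W], it is at least [b],
   which forces [m1 = 0]. *)
have a0 : (sgval a)@_0 != 0.
  have : mnm_of b \in msupp (sgval a * sgval f).
    by rewrite -E mcoeff_msupp mcoeff_mulX.
  case/msuppM_le/allpairsP => -[m1 m2] /= [Hm1 /Wf/bmin[le1 le2]].
  move/(congr1 (@expo)); rewrite mnm_ofK expoD => b12.
  suff m10 : m1 = 0%MM by rewrite -mcoeff_msupp -m10.
  have e1 : (expo m1).1 = 0%N by move: le1; rewrite b12 /=; lia.
  have e2 : (expo m1).2 = 0%N by move: le2; rewrite b12 /=; lia.
  by rewrite -[m1]expoK; apply/mnmP => i; rewrite mnmE e1 e2 mnm0E if_same.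
have : mnm_of w \in msupp (sgval a' * sgval s * 'X_[mnm_of b]).
  rewrite -mulrA E mulrCA -E' mulrA mcoeff_msupp mcoeff_mulX rmorphM /=.
  by rewrite mulf_neq0.
rewrite (perm_mem (msuppMX _ _)) => /mapP[g].
rewrite -sgvalM => /sgvalP Hg /(congr1 (@expo)).
by rewrite mnm_ofK expoD mnm_ofK => ->; exists (expo g).
Qed.

(** The monomial [x^b] generates the ideal globally, so the denominator 1 serves at every maximal
    ideal. *)
Lemma sgalg_translate_gorenstein (K : fieldType) (H : submonoid2)
    (W : nat * nat -> Prop) (b : nat * nat) :
  W b -> H b ->
  (forall w, W w -> exists2 g, H g & w = (b.1 + g.1, b.2 + g.2)%N) ->
  gorenstein_with_canonical
    (fun p : sgalg K H => forall m, m \in msupp (sgval p) -> W (expo m)).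
Proof.
move=> Wb Hb tr P [_ P1 _]; exists (sgmon K Hb); split.
- by move=> m; rewrite msuppX inE => /eqP->; rewrite mnm_ofK.
- move=> w Ww; exists 1.
  (* Subtraction of multinomials is truncated; it is exact here since each exponent of [w] is [b]
     plus an element of [H]. *)
  have shift m : m \in msupp (sgval w) ->
      H (expo (m - mnm_of b)%MM) /\ (m - mnm_of b + mnm_of b)%MM = m.
    move=> /Ww/tr[g Hg mE].
    have mD : m = (mnm_of g + mnm_of b)%MM.
      by apply: (can_inj expoK); rewrite expoD !mnm_ofK mE addnC [X in (_, X)]addnC.
    by rewrite mD addmK mnm_ofK.
  have aP : \sum_(m <- msupp (sgval w)) (sgval w)@_m *: 'X_[m - mnm_of b]
      \in sgalg_pred H.
    rewrite big_seq; apply: rpred_sum => m /shift[Hm _]; apply: rpredZ.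
    by rewrite -[(m - _)%MM]expoK; apply: sgmon_subproof.
  exists (SgAlg aP); split=> //; apply: val_inj; rewrite /= mul1r.
  rewrite [LHS]mpolyE mulr_suml; apply: eq_big_seq => m /shift[_ mE].
  by rewrite -scalerAl -mpolyXD mE.
- move=> a /(congr1 (@sgval _ _)); rewrite sgvalM sgval0 /= => /eqP.
  rewrite mulf_eq0 => a0; exists 1; split=> //; rewrite mul1r.
  apply: val_inj; rewrite /=; case/orP: a0 => /eqP // /(congr1 (mcoeff (mnm_of b))).
  by rewrite mcoeffX mcoeff0 eqxx => /eqP; rewrite oner_eq0.
Qed.

(** * Interior points of height one and the equivalence *)

(* Adding multiples of [a] to a Bezout solution keeps the value [e] and moves [z]
   towards [a], hence off the line through [c] on the required side. *)
Lemma det2_height (a : nat * nat) (c : int * int) (e : int) :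
  coprime a.1 a.2 -> det2 (vecZ a) c != 0 ->
  exists z, det2 (vecZ a) z = e /\ 0 < det2 (vecZ a) c * det2 z c.
Proof.
move=> /coprime_det2_1[z z1]; set d := det2 _ c => d0.
(* As [d ^+ 2] is at least 1, [k * d ^+ 2] outweighs the other summand whatever its sign. *)
set k := `|d * (e * det2 z c)| + 1.
exists (e * z.1 + k * a.1%:Z, e * z.2 + k * a.2%:Z); split.
  by rewrite -[RHS]mulr1 -z1 /det2 /=; ring.
have -> : d * det2 (e * z.1 + k * a.1%:Z, e * z.2 + k * a.2%:Z) c =
    d * (e * det2 z c) + k * d ^+ 2.
  by rewrite /d /det2 /=; ring.
have d2 : 1 <= d ^+ 2 by rewrite -gtz0_ge1 lt_neqAle eq_sym sqrf_eq0 d0 sqr_ge0.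
rewrite /k; move: (d * _) => x; nia.
Qed.

Lemma label_det2_gt0 (x1 y1 x2 y2 : nat) :
  (0 < x1)%N -> coprime x2 y2 ->
  x2 = 0%N \/ (y1%:R / x1%:R < y2%:R / x2%:R :> rat) ->
  0 < det2 (vecZ (x1, y1)) (vecZ (x2, y2)).
Proof.
rewrite /det2 /= => x1_gt0 cop label.
(* Splitting on [x2] first keeps division by zero out of the slope comparison. For [x2 = 0],
   coprimality gives [y2 = 1]. *)
have [x20|x2_gt0] := posnP x2.
  by move: cop; rewrite x20 /coprime gcd0n => /eqP->; rewrite !mulr0 subr0 mulr1.
case: label => [x20|]; first by rewrite x20 in x2_gt0.
rewrite ltr_pdivrMr ?ltr0n // mulrAC ltr_pdivlMr ?ltr0n // -!natrM ltr_nat; lia.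
Qed.

Theorem corollary5p17 (R : realType) (K : fieldType) (H : submonoid2)
    (x1 y1 x2 y2 u v : nat)
    (HN2 : normal_affine2 R H)
    (ray1 : extremal_ray R H (x1, y1)) (ray2 : extremal_ray R H (x2, y2))
    (x1_gt0 : (0 < x1)%N)
    (label : x2 = 0%N \/ (y1%:R / x1%:R < y2%:R / x2%:R :> rat))
    (bottom : bottom_element R H (u, v)) :
  semigroup_ring_gorenstein R K H <->
  (v%:Z * x1%:Z - u%:Z * y1%:Z = u%:Z * y2%:Z - v%:Z * x2%:Z /\
   u%:Z * y2%:Z - v%:Z * x2%:Z = 1).
Proof.
have [_ cop1 _] := ray1; have [_ cop2 _] := ray2.
have D0 : 0 < det2 (vecZ (x1, y1)) (vecZ (x2, y2)) := label_det2_gt0 x1_gt0 cop2 label.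
have om z := omegaP z ray1 ray2 D0.
have memH z := normal_memP z HN2 ray1 ray2 D0.
have omH z : omega R H z -> exists2 h, H h & z = vecZ h.
  by move/om => [L1 L2]; apply/memH; rewrite !ltW.
have vecZ_inj : injective vecZ by move=> [g1 g2] [h1 h2] [-> ->].
have vecZD (g h : nat * nat) : vecZ (g.1 + h.1, g.2 + h.2)%N =
    ((vecZ g).1 + (vecZ h).1, (vecZ g).2 + (vecZ h).2).
  by rewrite /vecZ /= !PoszD.
case: bottom => omb bmin; have [Lb1 Lb2] := (om _).1 omb.
have -> : v%:Z * x1%:Z - u%:Z * y1%:Z = det2 (vecZ (x1, y1)) (vecZ (u, v)).
  by rewrite /det2 /=; ring.
have -> : u%:Z * y2%:Z - v%:Z * x2%:Z = det2 (vecZ (u, v)) (vecZ (x2, y2)) by [].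
have anti (p q : int * int) : det2 p q = - det2 q p by rewrite /det2; ring.
have Homega h : omega R H (vecZ h) -> H h by move=> /omH[h' Hh' /vecZ_inj->].
have bleast h : omega R H (vecZ h) -> (u <= h.1)%N /\ (v <= h.2)%N.
  by move=> /bmin[].
split=> [gor|[L12 L2]].
  (* Here [w - b] lies in [H], where both determinants are nonnegative. *)
  have tr w : omega R H w ->
      det2 (vecZ (x1, y1)) (vecZ (u, v)) <= det2 (vecZ (x1, y1)) w /\
      det2 (vecZ (u, v)) (vecZ (x2, y2)) <= det2 w (vecZ (x2, y2)).
    move=> ow; have [h Hh wE] := omH _ ow; rewrite wE in ow *.
    have [g Hg ->] := @sgalg_gorenstein_translate K H (fun h => omega R H (vecZ h))
      (u, v) h Homega omb bleast gor ow.
    have /memH[g1 g2] : exists2 k, H k & vecZ g = vecZ k by exists g.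
    rewrite vecZD; move: g1 g2; rewrite /det2 /=; lia.
  (* An interior lattice point of height 1 over the first ray bounds the height of [b] by 1. *)
  have [z [z1 z2]] := det2_height 1 cop1 (lt0r_neq0 D0).
  have /tr[le1 _] : omega R H z by apply/om; rewrite z1; split; rewrite // -(pmulr_rgt0 _ D0).
  have D0' : 0 < - det2 (vecZ (x2, y2)) (vecZ (x1, y1)) by rewrite -anti.
  (* The height is -1 because [det2_height] takes the ray as first argument, which flips the
     sign. *)
  have [|w [w1 w2]] := @det2_height (x2, y2) (vecZ (x1, y1)) (-1) cop2.
    by rewrite -oppr_eq0 gt_eqF.
  have {}w1 : det2 w (vecZ (x2, y2)) = 1 by rewrite anti w1 opprK.
  have /tr[_ le2] : omega R H w.
    by apply/om; rewrite w1; split; rewrite // -(pmulr_rgt0 _ D0)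
      !(anti (vecZ (x1, y1))) mulrNN.
  move: le1 le2; rewrite z1 w1; lia.
rewrite L2 in L12.
apply: (@sgalg_translate_gorenstein K H (fun h => omega R H (vecZ h)) (u, v)) => //.
  exact: Homega.
move=> w /om[w1 w2].
(* Positive integer determinants at [w] are at least 1, their value at [b], so both are nonnegative
   at [w - b]. *)
have [|g Hg gE] := (memH (w.1%:Z - u%:Z, w.2%:Z - v%:Z)).2.
  move: L12 L2 w1 w2; rewrite /det2 /=; lia.
exists g => //; apply: vecZ_inj; rewrite vecZD -gE /vecZ /=.
by congr pair; lia.
Qed.
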